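(* Let $X$ be a nonempty set and $\tau$ a nonempty family of subsets of $X$ such that $(X,\tau)$ is $T_1$, and let $\beta$ be an ordinal of cofinality $\omega$. Then the following conditions are equivalent. (1) $(X,\tau)$ is $[\beta,\beta]$-compact. (2) $(X,\tau)$ is $[\beta+\alpha,\beta+\alpha]$-compact for every ordinal $\alpha$ with $|\alpha|\le\omega$. (3) $(X,\tau)$ is $[\beta+\alpha,\beta+\alpha]$-compact for some ordinal $\alpha$ with $|\alpha|\le\omega$. (4) $(X,\tau)$ is $[\beta,\beta+\omega_1)$-compact.
   Context: For a nonempty set $X$, a nonempty family $\tau$ of subsets of $X$ (not necessarily a topology) and nonzero ordinals $\alpha,\beta$, $(X,\tau)$ is $[\beta,\alpha]$-compact if, whenever $(O_\delta)_{\delta\in\alpha}$ is a sequence of members of $\tau$ (repetitions allowed) with $\bigcup_{\delta\in\alpha}O_\delta=X$, there is $H\subseteq\alpha$ of order type $<\beta$ (in the induced order) with $\bigcup_{\delta\in H}O_\delta=X$. $(X,\tau)$ is $[\beta,\alpha)$-compact if it is $[\beta,\alpha']$-compact for every nonzero $\alpha'<\alpha$. $(X,\tau)$ is $T_1$ if for every $O\in\tau$ and every $x\in O$, $O\setminus\{x\}\in\tau$ (for a topology $\tau$ this is the usual $T_1$ axiom). The operation $+$ is ordinal sum; the Axiom of Choice is assumed. *)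

(* Defs.v *)
From mathcomp Require Import all_boot.
From mathcomp Require Import wochoice all_classical.

Set Implicit Arguments.
Unset Strict Implicit.
Unset Printing Implicit Defensive.

Local Open Scope classical_set_scope.

(* Ordinals are represented by well-ordered types: a well-ordered type stands
   for its order type, and every notion below is invariant under isomorphism.
   The order is the non-strict one, as expected by [well_order]. *)
Record Ord := MkOrd {
  Ord_sort :> Type;
  Ord_le : rel Ord_sort;
  Ord_leP : well_order Ord_le }.

Definition ole (A : Ord) (x y : A) : bool := @Ord_le A x y.
Definition olt (A : Ord) (x y : A) : bool := ~~ ole y x.

Lemma ole_min (A : Ord) (S : set A) :
  S !=set0 -> exists2 z, S z & forall x, S x -> ole z x.
Proof.
move=> [x Sx]; have [|z [[zS zmin] _]] := @Ord_leP A (fun x => x \in S).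
  by exists x; rewrite unfold_in; apply/mem_set.
exists z; first by move: zS; rewrite unfold_in => /set_mem.
by move=> y Sy; apply: zmin; rewrite unfold_in; apply/mem_set.
Qed.

Lemma ole_total (A : Ord) : total (@ole A).
Proof.
move=> x y; have [|z zE zmin] := @ole_min A [set x; y]; first by exists x; left.
have [lx ly] : ole z x /\ ole z y by split; apply: zmin; [left|right].
by case: zE => /= <-; rewrite ?lx ?ly ?orbT.
Qed.

Lemma ole_refl (A : Ord) : reflexive (@ole A).
Proof. by move=> x; have := ole_total x x; rewrite orbb. Qed.

Lemma ole_anti (A : Ord) : antisymmetric (@ole A).
Proof.
move=> x y /andP[xy yx].
have [|z [_ zuniq]] := @Ord_leP A (fun z => z \in [set x; y]).
  by exists x; rewrite unfold_in; apply/mem_set; left.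
rewrite -(zuniq x) ?(zuniq y)//; split.
- by rewrite unfold_in; apply/mem_set; right.
- by move=> t; rewrite unfold_in => /set_mem[->|->]//; apply: ole_refl.
- by rewrite unfold_in; apply/mem_set; left.
- by move=> t; rewrite unfold_in => /set_mem[->|->]//; apply: ole_refl.
Qed.

Lemma ole_trans (A : Ord) : transitive (@ole A).
Proof.
move=> y x z xy yz.
have [|m mE mmin] := @ole_min A [set t | t = x \/ t = y \/ t = z].
  by exists x; left.
have mx : ole m x by apply: mmin; left.
have my : ole m y by apply: mmin; right; left.
have mz : ole m z by apply: mmin; right; right.
case: mE => [<-//|[my'|mz']].
  by rewrite -(_ : y = x)//; apply: ole_anti; rewrite xy -my' mx.
by rewrite -(_ : y = z)//; apply: ole_anti; rewrite yz -mz' my.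
Qed.

Lemma well_orderP (T : Type) (R : rel T) : antisymmetric R ->
  (forall S : set T, S !=set0 -> exists2 z, S z & forall x, S x -> R z x) ->
  well_order R.
Proof.
move=> Ranti Rmin; apply: antisymmetric_well_order => // S [x xS].
have [|z zS zmin] := Rmin [set x | x \in S]; first by exists x.
by exists z.
Qed.

Section Sub.
Variables (A : Ord) (H : set A).

Definition sub_le : rel (set_type H) := fun x y => ole (val x) (val y).

Lemma sub_leP : well_order sub_le.
Proof.
apply: well_orderP => [x y /ole_anti /val_inj//|S [x Sx]].
have [|_ [z Sz <-] zmin] := @ole_min A (val @` S); first by exists (val x), x.
by exists z => // y Sy; apply: zmin; exists y.
Qed.

Definition osub : Ord := MkOrd sub_leP.
End Sub.

Definition oiso (A B : Ord) : Prop :=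
  exists2 f : A -> B, bijective f & {mono f : x y / ole x y}.

Definition initial (A : Ord) (a : A) : set A := [set x | olt x a].

Definition ord_lt (A B : Ord) : Prop := exists b : B, oiso A (osub (initial b)).
Definition ord_le (A B : Ord) : Prop := ord_lt A B \/ oiso A B.

Definition nonzero (A : Ord) : Prop := [set: A] !=set0.

Section Sum.
Variables A B : Ord.

Definition sum_le (x y : A + B) : bool :=
  match x, y with
  | inl a, inl a' => ole a a'
  | inl _, inr _ => true
  | inr _, inl _ => false
  | inr b, inr b' => ole b b'
  end.

Lemma sum_leP : well_order sum_le.
Proof.
apply: well_orderP => [[a|b] [a'|b']//= /ole_anti->//|S [s Ss]].
have [/ole_min[z Sz zmin]|SA] := pselect ([set a | S (inl a)] !=set0).
  by exists (inl z) => // -[a Sa|]//=; apply: zmin.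
have [|z Sz zmin] := @ole_min B [set b | S (inr b)].
  by case: s Ss => [a Sa|b Sb]; [case: SA; exists a|exists b].
exists (inr z) => // -[a Sa|b Sb]/=; last exact: zmin.
by case: SA; exists a.
Qed.

Definition oadd : Ord := MkOrd sum_leP.
End Sum.

Lemma leq_well_order : well_order leq.
Proof.
apply: well_orderP => [|S [n Sn]]; first exact: anti_leq.
have exS : exists n, `[< S n >] by exists n; apply/asboolP.
case: (ex_minnP exS) => m /asboolP Sm mmin.
by exists m => // k Sk; apply: mmin; apply/asboolP.
Qed.

Definition omega : Ord := MkOrd leq_well_order.

(* omega_1: the points with countably many predecessors in some well-ordering
   of the power set of nat; see [omega1_uncountable] and
   [omega1_initial_countable]. *)
Definition continuum : Ord := MkOrd (svalP (well_ordering_principle (set nat))).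

Definition omega1 : Ord :=
  osub [set x : continuum | countable (initial x)].

Lemma countable_inj (T U : Type) (f : T -> U) (S : set T) (S' : set U) :
  injective f -> (forall x, S x -> S' (f x)) -> countable S' -> countable S.
Proof.
move=> finj SS' /countable_injP[g ginj]; apply/countable_injP; exists (g \o f).
move=> x y /set_mem Sx /set_mem Sy /= gfxy; apply: finj; apply: ginj gfxy.
  exact/mem_set/SS'.
exact/mem_set/SS'.
Qed.

Lemma omega1_initial_countable (x : omega1) : countable (initial x).
Proof. exact: (countable_inj (f := val) val_inj _ (set_mem (valP x))). Qed.

Lemma uncountable_set_nat : ~ countable [set: set nat].
Proof.
move=> /countable_injP[f finj].
pose D := [set n | exists2 S, f S = n & ~ S n].
have DI S : f S = f D -> S = D by move=> /finj; apply; exact: mem_set.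
have [DfD|nDfD] := pselect (D (f D)); last by apply: (nDfD); exists D.
by have [S /DI ->] := DfD.
Qed.

Lemma omega1_uncountable : ~ countable [set: omega1].
Proof.
move=> cT; pose S := [set x : continuum | countable (initial x)].
have cS : countable S.
  by rewrite -(eq_countable (card_setT S)).
have [[x Sx]|nS] := pselect ([set x | ~ S x] !=set0); last first.
  apply: uncountable_set_nat; apply: (countable_inj (f := id)) cS => // x _.
  by apply: contrapT => Sx; apply: nS; exists x.
have [|z Sz zmin] := @ole_min continuum [set x | ~ S x]; first by exists x.
apply: Sz; apply: (countable_inj (f := id)) cS => // y /= yz.
by apply: contrapT => /zmin zy; move: yz; rewrite /initial /= /olt zy.
Qed.

Definition cofinal (A : Ord) (C : set A) : Prop :=
  forall a : A, exists2 c, C c & ole a c.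

(* [has_cofinality A K]: K is the least order type of a cofinal subset of A. *)
Definition has_cofinality (A K : Ord) : Prop :=
  (exists2 C : set A, cofinal C & oiso (osub C) K) /\
  (forall C : set A, cofinal C -> ord_le K (osub C)).

Definition T1_family (X : Type) (tau : set (set X)) : Prop :=
  forall O, tau O -> forall x, O x -> tau (O `\ x).

Definition ord_compact (X : Type) (tau : set (set X)) (beta alpha : Ord) : Prop :=
  forall O : alpha -> set X, (forall d, tau (O d)) ->
    \bigcup_(d in [set: alpha]) O d = [set: X] ->
    exists H : set alpha,
      ord_lt (osub H) beta /\ \bigcup_(d in H) O d = [set: X].

Definition ord_compact_below (X : Type) (tau : set (set X)) (beta alpha : Ord)
  : Prop :=
  forall alpha' : Ord, nonzero alpha' -> ord_lt alpha' alpha ->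
    ord_compact tau beta alpha'.

(* Main.v *)
Require Import Defs.
From mathcomp Require Import all_boot.
From mathcomp Require Import wochoice all_classical.

Set Implicit Arguments.
Unset Strict Implicit.
Unset Printing Implicit Defensive.

Local Open Scope classical_set_scope.
Local Open Scope card_scope.

(** Everything is reduced to two transfers between covers indexed by beta and
    covers indexed by beta followed by a countable well-order K.

    Order types are compared through increasing maps: a set H of indices has
    type below C exactly when it maps increasingly into a proper initial segment
    of C, and otherwise C itself maps increasingly into H ([small_or_embeds]).

    The T1 property enters through [shrink_cover]. Suppose that the indices in N
    carry points x_i of O_i, and that each x_i lies in O_j only for j = i or j
    later than i, where only finitely many members of N are earlier than any
    given j. Removing from each O_j the finitely many x_i with i earlier than j
    leaves a cover in which O_i is the only member containing x_i, so that every
    subcover uses all of N.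

    Down to beta ([small_compact_of_oadd]). Let O be a cover indexed by beta
    without subcover of type below beta. The indices at which O covers a new
    point are cofinal, hence contain a cofinal sequence m of type omega, and
    [shrink_cover] makes every m_n indispensable. Moving countably many of the
    m_2n behind beta gives a cover indexed by beta + alpha. The part below beta
    of a subcover, together with all the m_n, is a subcover of O, so has type at
    least beta; inserting a sequence of type omega into a cofinal set does not
    increase its type ([absorb_cofinal_seq]), so that part has type at least
    beta by itself, and the subcover has type at least beta + alpha.

    Up from beta ([small_compact_extend]). Let O be indexed by beta + K with K
    countable, and let S be the set of points of beta whose tail is uncountable.
    Above any point of S there is still room in beta for a countable set
    ([small_setU]).
    If S is all of beta, a rearrangement of O in type beta, with K spread along
    a cofinal sequence, has a subcover of type below beta; putting all of K back
    behind its part in beta keeps the type below beta.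
    Otherwise beta \ S is a countable tail, and K is enlarged by that tail. If
    finitely many sets of K complete those of S to a cover, then they fit behind S
    in the infinite tail beta \ S without filling it. If not,
    [shrink_cover] makes infinitely many sets of K indispensable, and they can be
    reindexed by beta \ S. A subcover of type below beta of this new cover
    contains the whole tail beta \ S, which forces its part in S to be bounded
    inside S, and again K fits behind that part. *)

(** * Strict and weak order *)

Lemma oltNge (A : Ord) (x y : A) : olt x y = ~~ ole y x.
Proof. by []. Qed.

Lemma oleNgt (A : Ord) (x y : A) : ole x y = ~~ olt y x.
Proof. by rewrite /olt negbK. Qed.

Lemma oltxx (A : Ord) (x : A) : olt x x = false.
Proof. by rewrite /olt ole_refl. Qed.

Lemma oltW (A : Ord) (x y : A) : olt x y -> ole x y.
Proof. by rewrite /olt => /negbTE yx; have := ole_total x y; rewrite yx orbF. Qed.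

Lemma ole_lt_trans (A : Ord) (y x z : A) : ole x y -> olt y z -> olt x z.
Proof. by move=> xy; apply: contra => zx; apply: ole_trans zx xy. Qed.

Lemma olt_le_trans (A : Ord) (y x z : A) : olt x y -> ole y z -> olt x z.
Proof. by move=> xy yz; apply: contra xy => zx; apply: ole_trans yz zx. Qed.

Lemma olt_trans (A : Ord) (y x z : A) : olt x y -> olt y z -> olt x z.
Proof. by move=> xy /oltW; apply: olt_le_trans. Qed.

Lemma olt_total (A : Ord) (x y : A) : x <> y -> olt x y \/ olt y x.
Proof.
move=> xy; have [|] := boolP (ole x y); last by right.
by left; apply/negP => yx; apply: xy; apply: ole_anti; apply/andP.
Qed.

Lemma ole_eqVlt (A : Ord) (x y : A) : ole x y -> x = y \/ olt x y.
Proof.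
move=> xy; have [->|/olt_total[|yx]] := pselect (x = y); [by left|by right|].
by move: yx; rewrite oltNge xy.
Qed.

Lemma olt_wf (A : Ord) : well_founded (@olt A).
Proof.
move=> x; apply: contrapT => nx.
have [|z nz zmin] := @ole_min A [set x | ~ Acc (@olt A) x]; first by exists x.
apply: nz; constructor => y yz; apply: contrapT => /zmin.
by rewrite oleNgt yz.
Qed.

(** * Order types of subsets, via increasing maps *)

Definition increasing_on (A B : Ord) (H : set A) (f : A -> B) : Prop :=
  forall x y, H x -> H y -> olt x y -> olt (f x) (f y).

Definition small (C A : Ord) (H : set A) : Prop :=
  exists c : C, exists2 f : A -> C,
    increasing_on H f & forall x, H x -> olt (f x) c.

Lemma increasing_on_inj (A B : Ord) (H : set A) (f : A -> B) x y :
  increasing_on H f -> H x -> H y -> f x = f y -> x = y.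
Proof.
move=> fi Hx Hy fxy; apply: contrapT => /olt_total[] /fi => [/(_ Hx Hy)|/(_ Hy Hx)];
  by rewrite fxy oltxx.
Qed.

(** A least x in H with f x < x would be contradicted by f x itself. *)
Lemma increasing_on_ge (A : Ord) (H : set A) (f : A -> A) :
  increasing_on H f -> (forall x, H x -> H (f x)) ->
  forall x, H x -> ole x (f x).
Proof.
move=> fi fH x Hx; apply: contrapT => nx.
have [|z [Hz fz] zmin] := @ole_min A [set x | H x /\ ~ ole x (f x)].
  by exists x.
have {}fz : olt (f z) z by apply/negP.
suff /zmin : H (f z) /\ ~ ole (f z) (f (f z)) by rewrite oleNgt fz.
by split; [exact: fH|apply/negP; apply: fi => //; apply: fH].
Qed.

Lemma no_bounded_self_map (A : Ord) (f : A -> A) (c : A) :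
  increasing_on setT f -> ~ forall x, olt (f x) c.
Proof.
by move=> fi /(_ c); rewrite oltNge (increasing_on_ge fi).
Qed.

(** The Mostowski collapse of A into B: p x is the least element above all the
    earlier values, as long as there is one; the value b0 is used afterwards. *)
Lemma collapse (A B : Ord) (b0 : B) : exists p : A -> B,
  forall x c, (forall y, olt y x -> olt (p y) c) ->
    (forall y, olt y x -> olt (p y) (p x)) /\ ole (p x) c.
Proof.
have [least leastP] : exists m : set B -> B, forall S, S !=set0 ->
    S (m S) /\ forall d, S d -> ole (m S) d.
  suff /choice[m mP] : forall S : set B, exists b, S !=set0 ->
      S b /\ forall d, S d -> ole b d by exists m.
  move=> S; have [/ole_min[z Sz zmin]|] := pselect (S !=set0); first by exists z.
  by exists b0.
pose F (x : A) (p : forall y, olt y x -> B) : B :=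
  least [set c | forall y (yx : olt y x), olt (p y yx) c].
pose p := Fix (@olt_wf A) (fun=> B) F.
have pE x : p x = least [set c | forall y, olt y x -> olt (p y) c].
  rewrite {1}/p Fix_eq//= => z f g fg; congr (F z _).
  by apply: functional_extensionality_dep => y; apply: funext => yz.
exists p => x c cP; rewrite (pE x).
have [|h1 h2] := leastP [set c | forall y, olt y x -> olt (p y) c].
  by exists c.
by split=> //; apply: h2.
Qed.

(** If the collapse of A into B is bounded, its image is an initial segment of
    B. If it is unbounded, sending c to the first x with c <= p x maps B
    increasingly into A. *)
Lemma ord_lt_or_embeds (A B : Ord) :
  ord_lt A B \/ exists f : B -> A, increasing_on setT f.
Proof.
have [[b0 _]|B0] := pselect ([set: B] !=set0); last first.
  right; have f (b : B) : A by exfalso; apply: B0; exists b.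
  by exists f => x; exfalso; apply: B0; exists x.
have [p pP] := collapse A b0.
have [[c cP]|nb] := pselect (exists c, forall y, olt (p y) c).
  left; have [|{cP}c cP cmin] := @ole_min B [set c | forall y, olt (p y) c].
    by exists c.
  have pi x y : olt x y -> olt (p x) (p y).
    by apply: (proj1 (pP y c _)) => z _; apply: cP.
  have ple x y : ole (p x) (p y) = ole x y.
    apply/idP/idP; first by rewrite !oleNgt; apply: contra => /pi.
    by move=> /ole_eqVlt[->|/pi/oltW]//; rewrite ole_refl.
  have psurj d : olt d c -> exists y, p y = d.
    move=> dc; have [|y dy ymin] := @ole_min A [set y | ole d (p y)].
      apply: contrapT => nd; move: dc; rewrite oltNge => /negP; apply.
      apply: cmin => y; apply/negP => dy; apply: nd; by exists y.
    exists y; apply: ole_anti; apply/andP; split=> //.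
    apply: (proj2 (pP y d _)) => z zy; apply/negP => /ymin.
    by rewrite oleNgt zy.
  exists c.
  pose q (x : A) : osub (initial c) := SigSub (mem_set (cP x : initial c (p x))).
  have /choice[r rP] : forall d : osub (initial c), exists x, p x = val d.
    by move=> d; apply: psurj; apply: (set_mem (valP d)).
  exists q; last by move=> x y; rewrite /ole /= /sub_le /= ple.
  exists r => x; last by apply: val_inj; rewrite /= rP.
  by apply: ole_anti; rewrite -!ple rP /= ole_refl.
right.
(* two points c < d with the same first x would leave room for c at stage x,
   where the collapse would have taken a value at most c *)
have /choice[t tP] : forall c, exists z,
    ole c (p z) /\ forall y, ole c (p y) -> ole z y.
  move=> c; have [|y cy ymin] := @ole_min A [set y | ole c (p y)].
    apply: contrapT => nc; apply: nb; exists c => y; apply/negP => cy.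
    by apply: nc; exists y.
  by exists y.
exists t => c d _ _ cd; apply/negP => tdc.
have [ctc tc] := tP c; have [dtd td] := tP d.
have below z : olt z (t d) -> olt (p z) c.
  move=> ztd; apply/negP => /tc; rewrite oleNgt => /negP; apply.
  exact: olt_le_trans ztd tdc.
have [_] := pP (t d) c below.
by rewrite oleNgt (olt_le_trans cd dtd).
Qed.

(** The sets of indices of a subcover are subsets of A, so maps on the subtype
    are replaced by total maps that are increasing on the subset. *)
Lemma increasing_on_osub (A C : Ord) (H : set A) (c : C) (f : osub H -> C) :
  increasing_on setT f ->
  exists g : A -> C, increasing_on H g /\ forall x (Hx : H x),
    g x = f (SigSub (mem_set Hx)).
Proof.
move=> fi; pose g x := if pselect (H x) is left Hx then f (SigSub (mem_set Hx)) else c.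
have gE x (Hx : H x) : g x = f (SigSub (mem_set Hx)).
  rewrite /g; case: pselect => // Hx'; congr f; exact: val_inj.
by exists g; split=> // x y Hx Hy xy; rewrite !gE; apply: fi.
Qed.

Lemma small_or_embeds (A C : Ord) (H : set A) :
  small C H \/ exists f : C -> A, increasing_on setT f /\ forall x, H (f x).
Proof.
have [[c [f _ fle]]|[f fi]] := ord_lt_or_embeds (osub H) C; [left|right].
  have fi : increasing_on setT (fun x => val (f x)).
    move=> x y _ _; rewrite !oltNge; apply: contra.
    by move: (fle y x); rewrite {1}/ole /= /sub_le => ->.
  have [g [gi gE]] := @increasing_on_osub _ _ _ c _ fi.
  exists c, g => // x Hx; rewrite gE; exact: (set_mem (valP (f _))).
exists (fun x => val (f x)); split=> [x y _ _ xy|x]; first exact: fi.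
exact: (set_mem (valP (f x))).
Qed.

Lemma small_not_embeds (A C : Ord) (H : set A) (f : C -> A) :
  small C H -> increasing_on setT f -> (forall x, H (f x)) -> False.
Proof.
move=> [c [g gi gc]] fi fH.
apply: (@no_bounded_self_map C (g \o f) c); last by move=> x; apply: gc.
by move=> x y _ _ xy; apply: gi => //; apply: fi.
Qed.

Lemma ord_lt_osubP (A C : Ord) (H : set A) : ord_lt (osub H) C <-> small C H.
Proof.
split=> [AC|[c [f fi fc]]].
  have [//|[f [fi fH]]] := small_or_embeds C H.
  case: AC => c [g _ gle].
  exfalso; apply: (@no_bounded_self_map C
    (fun x => val (g (SigSub (mem_set (fH x))))) c) => [x y _ _ xy|x].
    rewrite oltNge; move: (gle (SigSub (mem_set (fH y))) (SigSub (mem_set (fH x)))).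
    by rewrite {1 2}/ole /= /sub_le /= => ->; apply: fi.
  exact: (set_mem (valP (g _))).
have [//|[g gi]] := ord_lt_or_embeds (osub H) C.
exfalso; apply: (@no_bounded_self_map C (fun x => f (val (g x))) c) => [x y _ _ xy|x].
  by apply: fi; [exact: (set_mem (valP (g x)))|exact: (set_mem (valP (g y)))|exact: gi].
by apply: fc; apply: (set_mem (valP (g x))).
Qed.

(** Compactness with the order type of the subcover expressed by increasing
    maps, which spares the subtype order on H. *)
Definition small_compact (X : Type) (tau : set (set X)) (beta A : Ord) : Prop :=
  forall O : A -> set X, (forall d, tau (O d)) -> (forall x, exists d, O d x) ->
    exists H : set A, small beta H /\ forall x, exists2 d, H d & O d x.

Lemma ord_compactE (X : Type) (tau : set (set X)) (beta A : Ord) :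
  ord_compact tau beta A <-> small_compact tau beta A.
Proof.
split=> cpt O Otau Ocov.
  have [|H [Hs Hcov]] := cpt O Otau.
    by apply/seteqP; split=> // x _; have [d] := Ocov x; exists d.
  exists H; split; first exact/ord_lt_osubP.
  by move=> x; have : [set: X] x by []; rewrite -Hcov => -[d]; exists d.
have [|H [Hs Hcov]] := cpt O Otau.
  by move=> x; have : [set: X] x by []; rewrite -Ocov => -[d]; exists d.
exists H; split; first exact/ord_lt_osubP.
by apply/seteqP; split=> // x _; have [d] := Hcov x; exists d.
Qed.

(** A weakly increasing p may identify points; one preimage for each point of
    the image suffices, and these are ordered as their images. *)
Lemma small_image (A B C : Ord) (H : set A) (p : A -> B) :
  (forall x y, H x -> H y -> ole x y -> ole (p x) (p y)) -> small C H ->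
  small C (p @` H).
Proof.
move=> pm Hs; have [//|[f [fi fH]]] := small_or_embeds C (p @` H).
have /choice[g gP] : forall x, exists y, H y /\ p y = f x.
  by move=> x; have [y Hy <-] := fH x; exists y.
exfalso; apply: (@small_not_embeds A C H g) => // [x y _ _ xy|x]; last by have [] := gP x.
have [Hx px] := gP x; have [Hy py] := gP y.
apply/negP => /(pm _ _ Hy Hx); rewrite px py oleNgt => /negP; apply; exact: fi.
Qed.

Lemma inj_card (T U : Type) (K : set T) (L : set U) (f : T -> U) :
  {in K &, injective f} -> (forall x, K x -> L (f x)) -> K #<= L.
Proof.
move=> /inj_card_eq fK KL; apply: card_le_trans (subset_card_le _ : f @` K #<= L).
  by have := fK; rewrite card_eq_le => /andP[].
by move=> _ [x Kx <-]; apply: KL.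
Qed.

Definition tail (A : Ord) (x : A) : set A := [set y | ole x y].

(** When the tail at s does not inject into K, the set K maps increasingly into
    a bounded part of that tail, and so fits behind the image of G. *)
Lemma small_setU (A beta : Ord) (G K : set A) (s : beta) (f : A -> beta) :
  increasing_on G f -> (forall x, G x -> olt (f x) s) ->
  (forall x y, G x -> K y -> olt x y) -> ~ (tail s #<= K) ->
  small beta (G `|` K).
Proof.
move=> fi fs GK sK.
have [[c [g gi gc]]|[g [gi gK]]] := @small_or_embeds A (osub (tail s)) K; last first.
  exfalso; apply: sK.
  apply: card_le_trans (_ : [set: osub (tail s)] #<= K).
    by have := card_setT (tail s); rewrite card_eq_le => /andP[].
  apply: (@inj_card _ _ _ _ g) => // x y _ _; exact: increasing_on_inj gi _ _.
have sle y : ole s (val (g y)) by apply: (set_mem (valP (g y))).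
have fs' x y : G x -> olt (f x) (val (g y)).
  by move=> /fs fxs; apply: olt_le_trans fxs (sle y).
exists (val c), (fun x => if pselect (G x) then f x else val (g x)) => [x y|x].
  case: pselect => [Gx|nGx] Hx; case: pselect => [Gy|nGy] Hy xy /=.
  - exact: fi.
  - exact: fs'.
  - by case: Hx => // /(GK _ _ Gy); move/oltW; rewrite oleNgt xy.
  - by case: Hx => // Kx; case: Hy => // Ky; apply: gi.
case: pselect => [Gx|nGx] Hx /=.
  by apply: olt_le_trans (fs _ Gx) _; apply: (set_mem (valP c)).
by case: Hx => // Kx; apply: gc.
Qed.

(** * Removing points from the members of a cover *)

Lemma T1_setD (X : Type) (tau : set (set X)) (U F : set X) :
  T1_family tau -> finite_set F -> tau U -> tau (U `\` F).
Proof.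
move=> T1 /finite_setP[n]; elim: n F => [|n IH] F.
  by rewrite II0 card_eq0 => /eqP -> Utau; rewrite setD0.
move=> /eq_cardSP[x Fx] /IH{}IH /IH UFx.
have [Ux|nUx] := pselect (U x).
  have -> : U `\` F = (U `\` (F `\ x)) `\ x.
    apply/seteqP; split=> y /= [].
      by move=> Uy Fy; split=> [|yx]; [split=> // -[]|apply: Fy; rewrite yx].
    by move=> [Uy Fy] yx; split=> // Fy'; apply: Fy.
  by apply: T1 => //; split=> // -[_]; apply.
have -> : U `\` F = U `\` (F `\ x); last exact: UFx.
apply/seteqP; split=> y /= [Uy Fy]; split=> //; first by case.
by move=> Fy'; apply: Fy; split=> // yx; apply: nUx; rewrite -yx.
Qed.

(** R i j reads as: i is earlier than j. A point x_i survives in O_i because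
    x_i = x_k with k earlier than i would put the same point in O_k, making i
    equal to or earlier than k. *)
Lemma shrink_cover (X I : Type) (tau : set (set X)) (O : I -> set X) (N : set I)
    (x : I -> X) (R : I -> I -> Prop) :
  T1_family tau -> (forall i, tau (O i)) -> (forall z, exists i, O i z) ->
  (forall i j, R i j -> ~ R j i) ->
  (forall j, finite_set [set i | N i /\ R i j]) ->
  (forall i, N i -> O i (x i)) ->
  (forall i j, N i -> O j (x i) -> j = i \/ R i j) ->
  exists P : I -> set X, [/\ forall i, tau (P i), forall i, P i `<=` O i,
    forall z, exists i, P i z & forall i j, N i -> P j (x i) -> j = i].
Proof.
move=> T1 Otau Ocov Rasym Rfin Ox xO.
exists (fun j => O j `\` (x @` [set i | N i /\ R i j])); split.
- move=> i; apply: T1_setD => //; exact: finite_image.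
- by move=> i z [].
- move=> z; have [[i Ni <-]|nz] := pselect ((x @` N) z).
    exists i; split; first exact: Ox.
    move=> [k [Nk Rki] xki]; have := Ox _ Nk; rewrite xki => Oki.
    have [eki|Rik] := xO _ _ Ni Oki; last exact: (Rasym _ _ Rik).
    by rewrite eki in Rki; apply: (Rasym _ _ Rki).
  have [i Oi] := Ocov z; exists i; split=> // -[k [Nk _] xk].
  by apply: nz; exists k.
- move=> i j Ni [Oj nj]; have [//|Rij] := xO _ _ Ni Oj.
  by exfalso; apply: nj; exists i.
Qed.

(** * Ordinals of countable cofinality *)

Definition cofinal_seq (A : Ord) (c : nat -> A) : Prop :=
  (forall n, olt (c n) (c n.+1)) /\ cofinal (range c).

Lemma has_cofinality_omega (A : Ord) :
  has_cofinality A omega -> exists c : nat -> A, cofinal_seq c.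
Proof.
move=> [[C Ccof [f [g fK gK] fle]] _].
exists (fun n => val (g n)); split=> [n|a].
  rewrite oltNge; have := fle (g n.+1) (g n); rewrite {2}/ole /= /sub_le => <-.
  by rewrite !gK /ole /= ltnn.
have [c Cc ac] := Ccof a; exists c => //.
by exists (f (SigSub (mem_set Cc))) => //=; rewrite fK.
Qed.

Section CofinalSeq.
Variables (A : Ord) (c : nat -> A).
Hypothesis cseq : cofinal_seq c.

Lemma cofinal_seq_lt m n : (m < n)%N -> olt (c m) (c n).
Proof.
have [cS _] := cseq; elim: n => // n IH; rewrite ltnS leq_eqVlt => /orP[/eqP->//|/IH].
by move=> /olt_trans; apply.
Qed.

Lemma cofinal_seq_le m n : (m <= n)%N -> ole (c m) (c n).
Proof. by rewrite leq_eqVlt => /orP[/eqP->|/cofinal_seq_lt/oltW]//; apply: ole_refl. Qed.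

Lemma cofinal_seq_lt_inv m n : olt (c m) (c n) -> (m < n)%N.
Proof. by rewrite ltnNge; apply: contra => /cofinal_seq_le. Qed.

Lemma cofinal_seq_inj : injective c.
Proof.
by move=> m n cmn; case: (ltngtP m n) => // /cofinal_seq_lt; rewrite cmn oltxx.
Qed.

Lemma cofinal_seq_ge x : exists n, ole x (c n).
Proof. by have [_ /(_ x)[_ [n _ <-] xn]] := cseq; exists n. Qed.

Lemma cofinal_seq_gt x : exists n, forall m, (n <= m)%N -> olt x (c m).
Proof.
have [n xn] := cofinal_seq_ge x; exists n.+1 => m nm.
exact: ole_lt_trans xn (cofinal_seq_lt nm).
Qed.

Lemma cofinal_seq_finite x : finite_set [set n | olt (c n) x].
Proof.
have [n nP] := cofinal_seq_gt x; apply: sub_finite_set (finite_II n) => m /= mx.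
by rewrite ltnNge; apply/negP => /nP /(olt_trans mx); rewrite oltxx.
Qed.

Lemma tail_infinite (x : A) : infinite_set (tail x).
Proof.
have [n nP] := cofinal_seq_gt x; apply/infiniteP.
apply: (@inj_card _ _ _ _ (fun k => c (n + k))) => [k l _ _|k _].
  by move=> /cofinal_seq_inj/eqP; rewrite eqn_add2l => /eqP.
by apply: oltW; apply: nP; apply: leq_addr.
Qed.

(** The n-th term is chosen above the previous one and above c n, which makes
    the sequence increasing and cofinal. *)
Lemma cofinal_subseq (M : set A) : cofinal M ->
  exists m : nat -> A, cofinal_seq m /\ forall n, M (m n).
Proof.
move=> Mcof.
have /choice[u uP] : forall p : A * A, exists z, [/\ M z, olt p.1 z & ole p.2 z].
  move=> [x y]; have [k kP] := cofinal_seq_gt x; have [l lP] := cofinal_seq_gt y.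
  have [z Mz cz] := Mcof (c (k + l)); exists z; split=> //=.
    by apply: olt_le_trans cz; apply: kP; apply: leq_addr.
  by apply: oltW; apply: olt_le_trans cz; apply: lP; apply: leq_addl.
pose m := fix m n := if n is n'.+1 then u (m n', c n) else u (c 0, c 0).
exists m; split; last first.
  by case=> [|n] /=; [have [] := uP (c 0, c 0)|have [] := uP (m n, c n.+1)].
split=> [n|a]; first by have [] := uP (m n, c n.+1).
have [n an] := cofinal_seq_ge a; exists (m n); first by exists n.
apply: ole_trans an _; case: n => [|n]; first by have [] := uP (c 0, c 0).
by have [] := uP (m n, c n.+1).
Qed.

(** The map sends x to the n-th successor in G of the first point of G from x
    on, where n counts the terms of c below x. Each term of c is thereby paid for
    by one step in G, which has no last point. *)
Lemma absorb_cofinal_seq (G : set A) : (forall x, exists2 g, G g & olt x g) ->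
  exists f : A -> A, (forall x, G (f x)) /\ increasing_on (G `|` range c) f.
Proof.
move=> Gunb.
have /choice[up upP] : forall x, exists g,
    [/\ G g, ole x g & forall g', G g' -> ole x g' -> ole g g'].
  move=> x; have [|g [Gg xg] gmin] := @ole_min A [set g | G g /\ ole x g].
    by have [g Gg /oltW xg] := Gunb x; exists g.
  by exists g; split=> // g' Gg' xg'; apply: gmin.
have /choice[s sP] : forall x, exists g,
    [/\ G g, olt x g & forall g', G g' -> olt x g' -> ole g g'].
  move=> x; have [|g [Gg xg] gmin] := @ole_min A [set g | G g /\ olt x g].
    by have [g Gg xg] := Gunb x; exists g.
  by exists g; split=> // g' Gg' xg'; apply: gmin.
have /choice[n nP] : forall x, exists n,
    ole x (c n) /\ forall k, ole x (c k) -> (n <= k)%N.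
  move=> x; have ex : exists n, ole x (c n) by apply: cofinal_seq_ge.
  by exists (ex_minn ex); case: ex_minnP.
have sG k x : G x -> G (iter k s x).
  by case: k => //= k _; have [] := sP (iter k s x).
have smono k x y : G x -> G y -> olt x y -> olt (iter k s x) (iter k s y).
  move=> Gx Gy xy; elim: k => //= k IH.
  have [_ _ /(_ _ (sG k _ Gy) IH) h] := sP (iter k s x).
  by apply: ole_lt_trans h _; have [] := sP (iter k s y).
have smonoW k x y : G x -> G y -> ole x y -> ole (iter k s x) (iter k s y).
  by move=> Gx Gy /ole_eqVlt[->|/(smono k _ _ Gx Gy)/oltW]//; apply: ole_refl.
have sgrow k l x : (k < l)%N -> olt (iter k s x) (iter l s x).
  elim: l => // l IH; rewrite ltnS leq_eqVlt => /orP[/eqP->|/IH kl] /=.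
    by have [] := sP (iter l s x).
  by apply: olt_trans kl _; have [] := sP (iter l s x).
have sgrowW k l x : (k <= l)%N -> ole (iter k s x) (iter l s x).
  by rewrite leq_eqVlt => /orP[/eqP->|/(sgrow _ _ x)/oltW]//; apply: ole_refl.
have Gup x : G (up x) by have [] := upP x.
exists (fun x => iter (n x) s (up x)); split=> [x|x y Hx Hy xy]; first exact: sG.
have upxy : ole (up x) (up y).
  have [_ _ h] := upP x; apply: h => //.
  by apply: ole_trans (oltW xy) _; have [] := upP y.
have nxy : (n x <= n y)%N.
  have [_ h] := nP x; apply: h; apply: ole_trans (oltW xy) _; by have [] := nP y.
case: Hx => [Gx|[k _ ckx]].
  apply: olt_le_trans (sgrowW _ _ _ nxy); apply: smono => //.
  have [_ yy _] := upP y; apply: olt_le_trans yy; apply: ole_lt_trans xy.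
  by have [_ _ h] := upP x; apply: h => //; apply: ole_refl.
apply: ole_lt_trans (smonoW _ _ _ (Gup x) (Gup y) upxy) _.
apply: sgrow; have [yn _] := nP y.
have [_ /(_ k)] := nP x; rewrite ckx ole_refl => /(_ isT) nk.
apply: leq_ltn_trans nk _; apply: cofinal_seq_lt_inv.
by rewrite ckx; apply: olt_le_trans xy yn.
Qed.

End CofinalSeq.

(** * From the longer covers back to beta *)

(** The terms of even rank of an indispensable cofinal sequence are moved behind
    beta; those of odd rank stay and keep the rest of any subcover cofinal. *)
Lemma small_compact_of_oadd (X : Type) (tau : set (set X)) (beta alpha : Ord)
    (c : nat -> beta) :
  [set: X] !=set0 -> T1_family tau -> cofinal_seq c ->
  countable [set: alpha] ->
  small_compact tau (oadd beta alpha) (oadd beta alpha) ->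
  small_compact tau beta beta.
Proof.
move=> [x0 _] T1 cseq /countable_injP[g ginj] cpt O Otau Ocov.
apply: contrapT => nO.
pose fresh d z := O d z /\ forall e, olt e d -> ~ O e z.
have freshP z : exists d, fresh d z.
  have [d Od dmin] := @ole_min beta [set d | O d z] (Ocov z).
  by exists d; split=> // e ed /dmin; rewrite oleNgt ed.
have freshcof : cofinal [set d | exists z, fresh d z].
  move=> a; apply: contrapT => na; apply: nO; exists (initial a); split.
    by exists a, id => [x y|].
  move=> z; have [d fd] := freshP z; exists d; last by have [] := fd.
  by apply/negP => ad; apply: na; exists d => //; exists z.
have [m [mseq mfresh]] := cofinal_subseq cseq freshcof.
have /choice[x xP] : forall d, exists z, range m d -> fresh d z.
  move=> d; have [[n _ <-]|nd] := pselect (range m d); last by exists x0.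
  by have [z fz] := mfresh n; exists z.
have [Q [Qtau QO Qcov Qx]] : exists Q : beta -> set X,
    [/\ forall i, tau (Q i), forall i, Q i `<=` O i,
    forall z, exists i, Q i z & forall i j, range m i -> Q j (x i) -> j = i].
  apply: (@shrink_cover _ _ _ O (range m) x (@olt beta)) => //.
  - by move=> i j /oltW; rewrite oleNgt => /negP.
  - move=> j; apply: sub_finite_set (finite_image m (cofinal_seq_finite mseq j)).
    by move=> _ [[n _ <-] mj]; exists n.
  - by move=> i /xP[].
  - move=> i j /xP[_ xi] Oj.
    have [|/olt_total[ji|]] := pselect (j = i); [by left| |by right].
    by have := xi _ ji Oj.
pose e a := m (g a).*2.
have einj : injective e.
  by move=> a b /(cofinal_seq_inj mseq)/double_inj/ginj; apply; exact: mem_set.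
have em a : range m (e a) by exists (g a).*2.
(* the index e a keeps its set, minus the point that only it covered, so that
   the copy of this set at inr a becomes indispensable instead *)
pose P (k : oadd beta alpha) := match k with
  | inl d => Q d `\` [set z | range e d /\ z = x d]
  | inr a => Q (e a) end.
have PQ d : P (inl d) `<=` Q d by move=> z [].
have [|z|H [Hs Hcov]] := cpt P.
- case=> [d|a] /=; last exact: Qtau.
  apply: T1_setD => //; apply: sub_finite_set (finite_set1 (x d)).
  by move=> z [].
- have [d Qd] := Qcov z.
  have [[[a _ ead] zx]|nd] := pselect (range e d /\ z = x d).
    by exists (inr a); rewrite /= ead.
  by exists (inl d); split.
have Hinr a : H (inr a).
  have [[d|b] Hk] := Hcov (x (e a)).
    move=> [Qd]; have dE := Qx _ _ (em a) Qd; rewrite dE => -[].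
    by split; first exists a.
  by move=> /(Qx _ _ (em a))/einj <-.
pose G := [set d | H (inl d)].
have Godd n : G (m n.*2.+1).
  have [[d|b] Hk] := Hcov (x (m n.*2.+1)).
    by move=> /PQ /Qx <- //; exists n.*2.+1.
  move=> /Qx => /(_ (imageT _ _))/(cofinal_seq_inj mseq) bn.
  by have := congr1 odd bn; rewrite /= !odd_double.
have [f [fG fi]] : exists f : beta -> beta, (forall x, G (f x)) /\
    increasing_on (G `|` range m) f.
  apply: absorb_cofinal_seq => // y; have [n nP] := cofinal_seq_gt mseq y.
  exists (m n.*2.+1) => //; apply: nP; rewrite -addnn.
  exact: leq_trans (leq_addr _ _) (leqnSn _).
(* a short G would give a short subcover of O, and a long one contains a copy of
   beta, to which all of alpha can be appended inside H *)
have [Gs|[k [ki kG]]] := small_or_embeds beta G.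
  apply: nO; exists (G `|` range m); split.
    have [s [h hi hs]] := Gs; exists s, (h \o f) => [y z Hy Hz yz|y _] /=.
      by apply: hi => //; apply: fi.
    exact: hs.
  move=> z; have [[d|a] Hk Pz] := Hcov z.
    by exists d; [left|exact: QO (PQ _ _ Pz)].
  by exists (e a); [right|apply: QO].
apply: (@small_not_embeds _ _ _ (fun p : oadd beta alpha =>
    match p with inl d => inl (k d) | inr a => inr a end : oadd beta alpha) Hs).
  by move=> [y|a] [z|b] _ _ //=; apply: ki.
by case=> [y|a]; [exact: kG|exact: Hinr].
Qed.

(** * From beta to longer covers *)

Definition uncountable_tails (A : Ord) : set A := [set x | ~ countable (tail x)].

Lemma uncountable_tails_down (A : Ord) (x y : A) :
  ole x y -> uncountable_tails y -> uncountable_tails x.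
Proof.
move=> xy; apply: contra_not; apply: sub_countable; apply: subset_card_le => z.
exact: ole_trans.
Qed.

(** The sets indexed by K, the complement of h(beta), are placed at a sparse set
    E of even-rank terms of c, and the map f spreads beta over the remaining
    positions. The weakly increasing left inverse r of f reads a position outside E
    back as an index in beta; it never increases order types,
    by [small_image]. *)
Lemma small_compact_interleave (X : Type) (tau : set (set X)) (beta A : Ord)
    (c : nat -> beta) (h : beta -> A) :
  cofinal_seq c -> increasing_on setT h ->
  (forall x a, ~ range h a -> olt (h x) a) -> countable (~` range h) ->
  (forall x : beta, uncountable_tails x) ->
  small_compact tau beta beta -> small_compact tau beta A.
Proof.
move=> cseq hi hlt ctb unc cpt O Otau Ocov; set K := ~` range h.
have /countable_injP[g ginj] := ctb.
pose E := [set c (g a).*2 | a in K].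
have [f [fE fi]] : exists f : beta -> beta, (forall x, ~ E (f x)) /\
    increasing_on ((~` E) `|` range c) f.
  apply: absorb_cofinal_seq => // y; have [n nP] := cofinal_seq_gt cseq y.
  exists (c n.*2.+1).
    move=> [a _ /(cofinal_seq_inj cseq) an].
    by have := congr1 odd an; rewrite /= !odd_double.
  apply: nP; rewrite -addnn; exact: leq_trans (leq_addr _ _) (leqnSn _).
have {}fi : increasing_on setT f.
  suff inE x : (~` E `|` range c) x by move=> x y _ _; apply: fi.
  have [[a _ <-]|nE] := pselect (E x); [by right; exists (g a).*2|by left].
have fge x : ole x (f x) by apply: (increasing_on_ge fi).
have /choice[r rP] : forall d, exists x, ole d (f x) /\
    forall y, ole d (f y) -> ole x y.
  move=> d; have [|x dx xmin] := @ole_min beta [set x | ole d (f x)].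
    by exists d; apply: fge.
  by exists x.
have rmono d e : ole d e -> ole (r d) (r e).
  have [_ h1] := rP d; have [h2 _] := rP e.
  by move=> de; apply: h1; apply: ole_trans de h2.
have rf x : r (f x) = x.
  have [h1 h2] := rP (f x); apply: ole_anti; apply/andP; split.
    exact: h2 (ole_refl _).
  rewrite oleNgt; apply/negP => /fi; rewrite oltNge h1 => /(_ I I).
  by [].
have /choice[p pP] : forall d, exists a,
    (exists2 b, K b & d = c (g b).*2 /\ a = b) \/ (~ E d /\ a = h (r d)).
  move=> d; have [[b Kb <-]|nE] := pselect (E d).
    by exists b; left; exists b.
  by exists (h (r d)); right.
have [|z|H [Hs Hcov]] := cpt (O \o p); first by move=> d; apply: Otau.
  have [a Oa] := Ocov z.
  have [[x _ hx]|Ka] := pselect (range h a).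
    exists (f x) => /=; have [[b Kb [fb _]]|[_ ->]] := pP (f x).
      by case: (fE x); exists b.
    by rewrite rf hx.
  exists (c (g a).*2) => /=; have [[b Kb [cab ->]]|[nE _]] := pP (c (g a).*2).
    move: cab => /(cofinal_seq_inj cseq)/double_inj ab.
    by rewrite -(ginj a b) //; exact: mem_set.
  by case: nE; exists a.
have rs : small beta ((h \o r) @` H).
  apply: small_image Hs => x y _ _ /rmono /ole_eqVlt[/= ->|/hi/oltW]; last exact.
  exact: ole_refl.
exists (((h \o r) @` H) `|` K); split.
  have [s [k ki ks]] := rs.
  apply: (small_setU ki ks) => [_ b [x _ <-] Kb|/sub_countable/(_ ctb)].
    exact: hlt.
  exact: unc.
move=> z; have [d Hd /= Od] := Hcov z; exists (p d) => //.
have [[b Kb [_ ->]]|[_ ->]] := pP d; first by right.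
by left; exists d.
Qed.

Lemma countable_setU (T : Type) (K L : set T) :
  countable K -> countable L -> countable (K `|` L).
Proof.
move=> cK cL; rewrite -bigcup2E; apply: bigcup_countable => //.
by move=> [|[|n]] _ //=; apply: countable0.
Qed.

(** Here S is the initial segment below the first point r with a countable tail,
    and K consists of all indices outside h(S): the countable set beyond h(beta)
    together with the copy of the tail at r. The set N keeps from K, in an
    enumeration g of type omega, the indices that cover a point missed by the
    sets of S and by the previous sets of K. *)
Lemma small_compact_countable_tail (X : Type) (tau : set (set X)) (beta A : Ord)
    (c : nat -> beta) (h : beta -> A) (t : beta) :
  [set: X] !=set0 -> T1_family tau ->
  cofinal_seq c -> increasing_on setT h ->
  (forall x a, ~ range h a -> olt (h x) a) -> countable (~` range h) ->
  countable (tail t) ->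
  small_compact tau beta beta -> small_compact tau beta A.
Proof.
move=> [x0 _] T1 cseq hi hlt ctb ctt cpt O Otau Ocov.
set S := @uncountable_tails beta.
have [|r nSr rmin] := @ole_min beta (~` S); first by exists t => /(_ ctt).
have SE x : S x <-> olt x r.
  split=> [Sx|xr]; first by apply/negP => /uncountable_tails_down /(_ Sx).
  by apply: contrapT => /rmin; rewrite oleNgt xr.
have nSE x : ~ S x <-> tail r x.
  by rewrite SE /tail /= oleNgt; split; [move/negP|move=> /negP].
have ctr : countable (tail r) by apply: contrapT => nctr; apply: nSr.
have inftr := (tail_infinite cseq (x := r)).
pose K := ~` (h @` S).
have cK : countable K.
  apply: sub_countable (countable_setU ctb (sub_countable (card_image_le h _) ctr)).
  apply: subset_card_le => a Ka.
  have [[x _ hx]|nh] := pselect (range h a); last by left.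
  by right; exists x => //; apply/nSE => Sx; apply: Ka; exists x.
have KT a x : S x -> K a -> olt (h x) a.
  move=> Sx Ka; have [[y _ hy]|/hlt//] := pselect (range h a).
  rewrite -hy; apply: hi => //; move/SE: Sx => xr; apply: olt_le_trans xr _.
  by apply/nSE => Sy; apply: Ka; exists y.
have /countable_injP[g ginj] := cK.
pose fresh a z := [/\ O a z, forall x, S x -> ~ O (h x) z &
  forall b, K b -> (g b < g a)%N -> ~ O b z].
pose N := [set a | K a /\ exists z, fresh a z].
have Ncov z : (exists2 x, S x & O (h x) z) \/ exists2 a, N a & O a z.
  have [|nS] := pselect (exists2 x, S x & O (h x) z); first by left.
  right; have ex : exists n, `[< exists a, [/\ K a, g a = n & O a z] >].
    have [a Oa] := Ocov z; exists (g a); apply/asboolP; exists a; split=> //.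
    by move=> [x Sx hx]; apply: nS; exists x; rewrite ?hx.
  case: (ex_minnP ex) => n /asboolP[a [Ka gan Oa] nmin].
  exists a => //; split=> //; exists z; split=> // [x Sx Ox|b Kb].
    by apply: nS; exists x.
  rewrite gan ltnNge => /negP gb Ob; apply: gb; apply: nmin.
  by apply/asboolP; exists b.
have NK : N `<=` K by move=> a [].
have [finN|infN] := pselect (finite_set N).
  have [s [k ki ks]] : small beta (h @` S).
    apply: (@small_image beta A beta S h).
      by move=> x y _ _ /ole_eqVlt[->|/hi/oltW]; [exact: ole_refl|exact].
    by exists r, id => // x /SE.
  exists (h @` S `|` N); split.
    apply: (small_setU ki ks) => [_ a [x Sx <-] /NK|/card_le_finite/(_ finN)].
      exact: KT.
    by move/(tail_infinite cseq).
  move=> z; have [[x Sx Oz]|[a Na Oz]] := Ncov z; last by exists a => //; right.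
  by exists (h x) => //; left; exists x.
(* N and the tail at r are both countably infinite, so P can use the tail of beta
   to index N *)
have cN : countable N by apply: sub_countable cK; apply: subset_card_le.
have /card_set_bijP[nN [_ nNinj nNsurj]] := eq_card_nat cN infN.
have /card_set_bijP[nT [_ nTinj nTsurj]] := eq_card_nat ctr inftr.
have /choice[p pP] : forall x, exists a,
    (S x /\ a = h x) \/ [/\ ~ S x, N a & nN a = nT x].
  move=> x; have [Sx|nSx] := pselect (S x); first by exists (h x); left.
  by have [a Na an] := nNsurj (nT x) I; exists a; right.
have pS x : S x -> p x = h x by case: (pP x) => [[]|[]].
have pN x : ~ S x -> N (p x) /\ nN (p x) = nT x by case: (pP x) => [[]|[]].
have pinj x y : ~ S x -> ~ S y -> p x = p y -> x = y.
  move=> nx ny pxy; apply: nTinj; rewrite ?inE; [exact/nSE|exact/nSE|].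
  by have [_ <-] := pN _ nx; have [_ <-] := pN _ ny; rewrite pxy.
have gpinj x y : ~ S x -> ~ S y -> g (p x) = g (p y) -> x = y.
  move=> nx ny gxy; apply: pinj => //; apply: ginj => //; rewrite inE; apply: NK.
    by have [] := pN _ nx.
  by have [] := pN _ ny.
have /choice[w wP] : forall x, exists z, ~ S x -> fresh (p x) z.
  move=> x; have [Sx|nSx] := pselect (S x); first by exists x0.
  by have [[_ [z fz]] _] := pN _ nSx; exists z.
have [P [Ptau PO Pcov Pw]] : exists P : beta -> set X,
    [/\ forall i, tau (P i), forall i, P i `<=` O (p i),
    forall z, exists i, P i z & forall i j, ~ S i -> P j (w i) -> j = i].
  apply: (@shrink_cover _ _ _ (O \o p) (~` S) w
    (fun i j => [/\ ~ S i, ~ S j & (g (p i) < g (p j))%N])) => //.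
  - by move=> i; apply: Otau.
  - move=> z; have [[x Sx Oz]|[a Na Oz]] := Ncov z.
      by exists x; rewrite /= pS.
    have [x /nSE nSx xa] := nTsurj (nN a) I.
    exists x => /=; suff -> : p x = a by [].
    have [Np px] := pN _ nSx.
    by apply: nNinj; rewrite ?inE // px.
  - by move=> i j [_ _ ij] [_ _]; rewrite ltnNge (ltnW ij).
  - move=> j; apply: card_le_finite (finite_II (g (p j))).
    apply: (@inj_card _ _ _ _ (g \o p)) => [x y|x [_ [_ _]]//].
    by rewrite !inE => -[_ [nx _ _]] [_ [ny _ _]]; apply: gpinj.
  - by move=> i /wP[].
  - move=> i j nSi /= Oj; have [Oi Si Ki] := wP _ nSi.
    have [Sj|nSj] := pselect (S j); first by case: (Si _ Sj); rewrite -pS.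
    have [Nj _] := pN _ nSj.
    have [ji|ij|ij] := ltngtP (g (p j)) (g (p i)).
    + by case: (Ki _ (NK _ Nj) ji).
    + by right.
    + by left; apply: gpinj.
have [H [[s [k ki ks]] Hcov]] := cpt P Ptau Pcov.
have TH x : ~ S x -> H x.
  by move=> nSx; have [d Hd /(Pw _ _ nSx) <-] := Hcov (w x).
(* otherwise k would map the whole tail at r, which lies in H, increasingly into
   itself, with a bound inside that tail *)
have Skr : S (k r).
  apply: contrapT => nSk.
  have kT x : ~ S x -> ~ S (k x).
    move=> nSx; apply/nSE; have /nSE rx := nSx; move/nSE: nSk => rk.
    apply: ole_trans rk _; have [<-|/ki/oltW] := ole_eqVlt rx; first exact: ole_refl.
    by apply; apply: TH.
  have nSs : ~ S s.
    apply/nSE; move/nSE: nSk => rk; apply: ole_trans rk _.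
    by apply: oltW; apply: ks; apply: TH.
  have := ks _ (TH _ nSs); rewrite oltNge => /negP; apply.
  apply: (@increasing_on_ge _ (~` S)) => // x y /TH Hx /TH Hy; exact: ki.
have hlt_inv x y : olt (h x) (h y) -> olt x y.
  move=> hxy; apply/negP => /ole_eqVlt[yx|/hi yx].
    by move: hxy; rewrite yx oltxx.
  by move: hxy; rewrite oltNge (oltW (yx _ _)).
have /choice[u uP] : forall a, exists x, range h a -> h x = a.
  move=> a; have [[x _ <-]|na] := pselect (range h a); first by exists x.
  by exists r.
have uh x : u (h x) = x.
  apply: increasing_on_inj hi I I _; apply: uP; exact: imageT.
exists (h @` (H `&` S) `|` K); split.
  apply: (@small_setU _ _ _ _ (k r) (k \o u)).
  - move=> _ _ [x [Hx _] <-] [y [Hy _] <-] /=.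
    by rewrite !uh => /hlt_inv; apply: ki.
  - by move=> _ [x [Hx Sx] <-] /=; rewrite uh; apply: ki => //; [exact: TH|exact/SE].
  - by move=> _ a [x [_ Sx] <-]; apply: KT.
  - by move=> /sub_countable/(_ cK); apply: Skr.
move=> z; have [d Hd /PO Oz] := Hcov z; exists (p d) => //.
have [Sd|nSd] := pselect (S d); first by left; exists d; rewrite ?pS.
by right; apply: NK; have [] := pN _ nSd.
Qed.

Lemma small_compact_extend (X : Type) (tau : set (set X)) (beta A : Ord)
    (c : nat -> beta) (h : beta -> A) :
  [set: X] !=set0 -> T1_family tau ->
  cofinal_seq c -> increasing_on setT h ->
  (forall x a, ~ range h a -> olt (h x) a) -> countable (~` range h) ->
  small_compact tau beta beta -> small_compact tau beta A.
Proof.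
move=> X0 T1 cseq hi hlt ctb cpt.
have [[t ctt]|nt] := pselect (exists t : beta, countable (tail t)).
  exact: (small_compact_countable_tail X0 T1 cseq hi hlt ctb ctt cpt).
apply: (small_compact_interleave cseq hi hlt ctb _ cpt) => t ctt.
by apply: nt; exists t.
Qed.

Lemma small_compact_oadd (X : Type) (tau : set (set X)) (beta alpha : Ord)
    (c : nat -> beta) :
  [set: X] !=set0 -> T1_family tau -> cofinal_seq c ->
  countable [set: alpha] -> small_compact tau beta beta ->
  small_compact tau (oadd beta alpha) (oadd beta alpha).
Proof.
move=> X0 T1 cseq calpha cpt.
pose inlb (x : beta) : oadd beta alpha := inl x.
have ext : small_compact tau beta (oadd beta alpha).
  apply: (@small_compact_extend _ _ _ _ c inlb) => //.
  - by move=> x [y nr|//]; case: nr; exists y.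
  - apply: sub_countable calpha.
    apply: card_le_trans (card_image_le (inr : alpha -> oadd beta alpha) _).
    by apply: subset_card_le => -[y nr|a _]; [case: nr; exists y|exists a].
move=> O Otau Ocov; have [H [[s [f fi fs]] Hcov]] := ext O Otau Ocov.
by exists H; split=> //; exists (inlb s), (inlb \o f).
Qed.

(** An order type below beta + omega1 is either below beta, and then any cover is
    its own small subcover, or beta followed by a countable initial segment of
    omega1. *)
Lemma small_compact_below (X : Type) (tau : set (set X)) (beta A : Ord)
    (c : nat -> beta) :
  [set: X] !=set0 -> T1_family tau -> cofinal_seq c ->
  ord_lt A (oadd beta omega1) -> small_compact tau beta beta ->
  small_compact tau beta A.
Proof.
move=> X0 T1 cseq [b [f [g fK gK] fle]] cpt.
have fb a : olt (val (f a)) b := set_mem (valP (f a)).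
have flt a a' : olt a a' = olt (val (f a)) (val (f a')).
  by rewrite !oltNge -fle.
case: b f g fK gK fle fb flt => [b|w] f g fK gK fle fb flt.
  move=> O Otau Ocov; exists setT; split; last by move=> x; have [d] := Ocov x; exists d.
  exists b, (fun a => if val (f a) is inl x then x else b) => [x y _ _|x _].
    by rewrite flt; move: (fb x) (fb y); case: (val (f x)) (val (f y)) => [?|?] [?|?].
  by move: (fb x); case: (val (f x)).
have inlw (x : beta) : initial (inr w : oadd beta omega1) (inl x) by [].
pose h x := g (SigSub (mem_set (inlw x))).
have fh x : val (f (h x)) = inl x by rewrite gK.
have nh a : ~ range h a -> exists2 y, val (f a) = inr y & olt y w.
  move=> nr; case E : (val (f a)) (fb a) => [x|y] yw; last by exists y.
  case: nr; exists x => //; rewrite /h -[RHS]fK; congr g; exact: val_inj.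
apply: (@small_compact_extend _ _ _ _ c h) => //.
- by move=> x y _ _; rewrite flt !fh.
- by move=> x a /nh[y ay _]; rewrite flt fh ay.
- apply: sub_countable (omega1_initial_countable w).
  apply: (@inj_card _ _ _ _ (fun a => if val (f a) is inr y then y else w)).
    move=> x y; rewrite !inE => /nh[u xu _] /nh[v yv _]; rewrite xu yv => uv.
    by rewrite -[x]fK -[y]fK; congr g; apply: val_inj; rewrite xu yv uv.
  by move=> x /nh[u xu uw]; rewrite xu.
Qed.

Theorem theorem6p6 (X : Type) (tau : set (set X)) (beta : Ord) :
  [set: X] !=set0 ->
  tau !=set0 ->
  T1_family tau ->
  has_cofinality beta omega ->
  [<-> ord_compact tau beta beta;
       forall alpha : Ord, countable [set: alpha] ->
         ord_compact tau (oadd beta alpha) (oadd beta alpha);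
       exists2 alpha : Ord, countable [set: alpha] &
         ord_compact tau (oadd beta alpha) (oadd beta alpha);
       ord_compact_below tau beta (oadd beta omega1)].
Proof.
move=> X0 _ T1 /has_cofinality_omega[c cseq]; tfae.
- move=> /ord_compactE cpt alpha calpha; apply/ord_compactE.
  exact: small_compact_oadd X0 T1 cseq calpha cpt.
- move=> cpt; have comega : countable [set: omega] by apply/card_lexx.
  by exists omega => //; apply: cpt.
- move=> [alpha calpha /ord_compactE cpt] A _ AB; apply/ord_compactE.
  apply: (small_compact_below X0 T1 cseq AB).
  exact: small_compact_of_oadd X0 T1 cseq calpha cpt.
- apply; first by exists (c 0).
  have [w _] : [set: omega1] !=set0.
    by apply/set0P/eqP => w0; apply: omega1_uncountable; rewrite w0; apply: countable0.
  have [w0 _ wmin] := @ole_min omega1 setT (ex_intro _ w I).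
  have inlP (x : beta) : initial (inr w0 : oadd beta omega1) (inl x) by [].
  pose beta' := osub (initial (inr w0 : oadd beta omega1)).
  exists (inr w0), (fun x => SigSub (mem_set (inlP x)) : beta'); last by [].
  exists (fun k => if val k is inl x then x else c 0) => [//|k].
  have kw : olt (val k : oadd beta omega1) (inr w0) := set_mem (valP k).
  apply: val_inj; move: kw; case: (val k) => [x|y] //=.
  by rewrite oltNge /ole /= => /negP; case; apply: wmin.
Qed.
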